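(* For each $d$ in an infinite set of positive integers $d\geq 2$, let $G$ be a chain of connected graphs $G_1,\dots,G_d$ with respect to the path on $d$ vertices, where $|V(G_1)|=|V(G_d)|=d$ and $|V(G_2)|=\cdots=|V(G_{d-1})|=1$, and let $n=|V(G)|$ (so that $d=\Theta(n)$). Assume that, along this family, the numbers of edges of $G_1$ and $G_d$ satisfy $m_{G_1}=\Theta(d^2)$ and $m_{G_d}=\Theta(d^2)$. Then, as $n\to\infty$, \[ \mathcal{K}(G)\,\mathcal{K}(\overline{G})=\Theta(n^4). \]
   Context: Graphs are finite, simple, undirected and unweighted. $\overline{G}$ is the complement of $G$. A chain of connected graphs $G_1,\dots,G_d$ with respect to the path $1,2,\dots,d$ is a graph obtained from the disjoint union of $G_1,\dots,G_d$ by choosing, for each $i=1,\dots,d-1$, a vertex $x_i\in V(G_i)$ and a vertex $y_i\in V(G_{i+1})$ and adding the edge $\{x_i,y_i\}$ (which is then a bridge). For a connected graph $G$ with vertex set $\{1,\dots,n\}$, $m$ edges and vertex degrees $d_1,\dots,d_n$, Kemeny's constant is $\mathcal{K}(G)=\sum_{j\neq i}\frac{d_j}{2m}\,m_{i,j}$, where $m_{i,j}$ is the expected first time at which the simple random walk on $G$ (which moves at each step to a uniformly random neighbour) started at $i$ reaches $j$; this value does not depend on the choice of $i$. Asymptotic notation: $f=O(g)$ means $\limsup f/g$ is finite along the family, and $f=\Theta(g)$ means $f=O(g)$ and $g=O(f)$. *)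

(* Defs.v *)
From HB Require Import structures.
From mathcomp Require Import all_boot all_order all_algebra.
From mathcomp Require Import all_classical all_reals all_analysis.
Import Order.TTheory GRing.Theory Num.Theory.
Import numFieldNormedType.Exports.

Set Implicit Arguments.
Unset Strict Implicit.
Unset Printing Implicit Defensive.

Local Open Scope classical_set_scope.
Local Open Scope ring_scope.

Record sgraph := SGraph {
  svertex :> finType;
  sedge : rel svertex;
  sedge_sym : symmetric sedge;
  sedge_irr : irreflexive sedge }.

Definition gconnected (G : sgraph) : Prop :=
  forall u v : G, connect (@sedge G) u v.

Definition degree (G : sgraph) (u : G) : nat := #|[set v | sedge u v]%SET|.

Definition nvertices (G : sgraph) : nat := #|svertex G|.

Definition nedges (G : sgraph) : nat :=
  #|[set A : {set G} | [exists u, exists v, sedge u v && (A == [set u; v])]]%SET|.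

Section Complement.
Variable G : sgraph.

Definition compl_edge : rel G := fun u v => (u != v) && ~~ sedge u v.

Lemma compl_edge_sym : symmetric compl_edge.
Proof. by move=> u v; rewrite /compl_edge eq_sym sedge_sym. Qed.

Lemma compl_edge_irr : irreflexive compl_edge.
Proof. by move=> u; rewrite /compl_edge eqxx. Qed.

Definition complement : sgraph := SGraph compl_edge_sym compl_edge_irr.
End Complement.

(* Pieces are numbered from 0, so [H 0, ..., H d.-1] are G_1, ..., G_d; the
   graphs [H i] with [d <= i] play no role.  Both [x] and [y] are indexed by
   the piece containing the vertex: the bridge between pieces [i] and [i.+1]
   joins [x i] to [y i.+1]; [x d.-1] and [y 0] are not used. *)
Section Chain.
Variables (d : nat) (H : nat -> sgraph) (x y : forall i, H i).

Definition chain_vertex : finType := {i : 'I_d & H i}.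

Definition bridge (u v : chain_vertex) : bool :=
  [&& (tag u).+1 == tag v :> nat,
      tagged u == x (tag u) & tagged v == y (tag v)].

Definition chain_edge : rel chain_vertex := fun u v =>
  [|| (tag u == tag v) && sedge (tagged u) (tagged_as u v),
      bridge u v | bridge v u].

Lemma chain_edge_sym : symmetric chain_edge.
Proof.
move=> u v; rewrite /chain_edge [bridge u v || _]orbC; congr (_ || _).
case: u v => [i a] [j b] /=; case: (eqVneq i j) b => //= <- b.
pose T (k : 'I_d) : Type := H k.
rewrite (tagged_asE (T_ := T) (u := Tagged T a)).
by rewrite (tagged_asE (T_ := T) (u := Tagged T b)) sedge_sym.
Qed.

Lemma chain_edge_irr : irreflexive chain_edge.
Proof.
move=> u; case: u => i a; pose T (k : 'I_d) : Type := H k.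
rewrite /chain_edge /bridge /= (tagged_asE (T_ := T) (u := Tagged T a)).
by rewrite sedge_irr andbF eqn_leq ltnn.
Qed.

Definition chain : sgraph := SGraph chain_edge_sym chain_edge_irr.
End Chain.

Section Kemeny.
Variables (R : realType) (G : sgraph).

Definition transition (u v : G) : R :=
  if sedge u v then (degree u)%:R^-1 else 0.

(* P(X_1 = s_1, ..., X_t = s_t | X_0 = u) for the simple random walk X. *)
Fixpoint walk_prob (u : G) (s : seq G) : R :=
  if s is v :: s' then transition u v * walk_prob v s' else 1.

(* P(T_j = t | X_0 = i), where T_j is the first t >= 0 with X_t = j; [index]
   returns the first occurrence, and [t.+1] when j does not occur. *)
Definition hit_prob (i j : G) (t : nat) : R :=
  \sum_(s : t.-tuple G | index j (i :: s) == t) walk_prob i s.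

(* The second term is the contribution of the event T_j = +oo; it vanishes
   when that event has probability 0, since +oo * 0 = 0 in \bar R. *)
Definition mean_hitting_time (i j : G) : \bar R :=
  (\sum_(0 <= t <oo) (t%:R * hit_prob i j t)%:E
   + +oo * (1 - \sum_(0 <= t <oo) (hit_prob i j t)%:E))%E.

Definition kemeny_from (i : G) : \bar R :=
  (\sum_(j | j != i)
     ((degree j)%:R / (2 * (nedges G)%:R))%:E * mean_hitting_time i j)%E.

(* The common value of [kemeny_from i] over all starting vertices i (and +oo
   if there were no such common value). *)
Definition kemeny : \bar R := xget +oo%E [set k | forall i, kemeny_from i = k].
End Kemeny.

(* f = Theta(g) along d -> +oo, d ranging over the index set D. *)
Definition Theta_along (R : realType) (D : set nat) (f g : nat -> R^o) : Prop :=
  let F := within D \oo in f =O_F g /\ g =O_F f.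

(* Main.v *)
From HB Require Import structures.
Require Import Defs.
From mathcomp Require Import all_boot all_order all_algebra.
From mathcomp Require Import all_classical all_reals all_analysis.
From mathcomp Require Import ring lra zify.
Import Order.TTheory GRing.Theory Num.Theory.
Import numFieldNormedType.Exports.

Set Implicit Arguments.
Unset Strict Implicit.
Unset Printing Implicit Defensive.

Local Open Scope classical_set_scope.
Local Open Scope ring_scope.

(** Write n for the number of vertices of the chain G, which is 3d - 2.  The
    two factors are of order n^3 and n respectively.

    Everything goes through one characterization: on a connected graph the mean
    hitting time of j is the unique function h with h(j) = 0 whose Laplacian,
    sum over v ~ u of (h(u) - h(v)), equals deg(u) at every u other than j
    ([mean_hitting_timeP]).  Uniqueness is the minimum principle, existence
    follows by finite dimension, and the series defining the mean hitting time
    are dominated by h, so they converge to a solution.  At j the Laplacian is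
    deg(j) - 2m because Laplacians sum to 0; hence sum_j deg(j) h_j is harmonic
    and therefore constant, which is why Kemeny's constant does not depend on
    the starting vertex ([fine_kemeny]).

    Summing the Laplacian over a vertex set S that avoids j shows that the total
    drop of h_j across the edges leaving S is the sum of the degrees in S.
    - Taking for S a superlevel set, h_j drops by at most 2m along an edge, so
      h_j <= 2m n <= n^3 and K(G) <= n^3 ([hitting_le]).
    - Taking for S everything on the left of a bridge of the chain, h_j drops by
      at least twice the number of edges of the first piece, of order d^2, at
      each of the d - 1 bridges.  Thus reaching the last piece from the first
      takes time of order d^3, and the last piece carries a positive fraction of
      the stationary mass: K(G) is at least of order d^3 ([chain_kemeny_ge]).

    The complement of G is dense: degrees in G are at most d + 2, so degrees in
    the complement exceed n/2 by a quantity of order n, and any two vertices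
    have of order n common neighbours.  Then two steps of the walk hit j with
    probability of order at least 1/n, so hitting times are O(n)
    ([hitting_le_common]); and one step hits j with probability at most the
    inverse of the minimum degree, so hitting times are also at least that
    minimum degree ([hitting_ge_degree]). *)

(** * Degrees and the graph Laplacian *)

Lemma degree_sum (R : pzSemiRingType) (G : sgraph) (u : G) :
  (degree u)%:R = \sum_(v | sedge u v) 1 :> R.
Proof. by rewrite /degree -sum1dep_card natr_sum. Qed.

(** Each edge {u, v} arises from exactly the two ordered pairs (u, v) and
    (v, u). *)
Lemma sum_degree (G : sgraph) :
  (\sum_(u : G) degree u = 2 * nedges G)%N.
Proof.
pose E := [set A : {set G} | [exists u, exists v, sedge u v && (A == [set u; v]%SET)]]%SET.
have -> : (\sum_(u : G) degree u = \sum_(u : G) \sum_(v : G | sedge u v) 1)%N.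
  by apply: eq_bigr => u _; rewrite /degree -sum1dep_card.
rewrite pair_big_dep /=.
rewrite (partition_big (fun p : G * G => [set p.1; p.2]%SET) (mem E)) /=; last first.
  move=> [u v] /= uv; rewrite inE; apply/existsP; exists u; apply/existsP.
  by exists v; rewrite uv eqxx.
rewrite [nedges G](_ : _ = #|E|) // mulnC -sum_nat_const.
apply: eq_bigr => A; rewrite inE => /existsP[u /existsP[v /andP[uv /eqP ->]]].
have uDv : u != v by apply: contraTneq uv => ->; rewrite sedge_irr.
rewrite (bigD1 (u, v)) /=; last by rewrite uv eqxx.
rewrite (bigD1 (v, u)) /=; last first.
  by rewrite sedge_sym uv finset.setUC eqxx /= xpair_eqE eq_sym negb_and uDv.
rewrite big1 // => -[a b] /=; rewrite !xpair_eqE => /andP[/andP[/andP[ab /eqP e] h1] h2].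
have /finset.set2P ha : a \in [set u; v]%SET by rewrite -e finset.set21.
have /finset.set2P hb : b \in [set u; v]%SET by rewrite -e finset.set22.
move: ab h1 h2; case: ha => ->; case: hb => ->; rewrite ?eqxx //= ?sedge_irr //.
Qed.

Definition laplacian (R : pzRingType) (G : sgraph) (h : G -> R) (u : G) : R :=
  \sum_(v | sedge u v) (h u - h v).

Lemma laplacianE (R : pzRingType) (G : sgraph) (h : G -> R) (u : G) :
  laplacian h u = (degree u)%:R * h u - \sum_(v | sedge u v) h v.
Proof.
rewrite /laplacian sumrB degree_sum mulr_suml; congr (_ - _).
by apply: eq_bigr => v _; rewrite mul1r.
Qed.

Lemma laplacianB (R : pzRingType) (G : sgraph) (h k : G -> R) (u : G) :
  laplacian (fun v => h v - k v) u = laplacian h u - laplacian k u.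
Proof.
rewrite /laplacian -sumrB; apply: eq_bigr => v _.
by rewrite !opprD !opprK addrACA.
Qed.

(** The contributions of the edges inside S cancel by antisymmetry, so only the
    flow through the boundary of S remains. *)
Lemma sum_laplacian (R : comPzRingType) (G : sgraph) (h : G -> R) (S : {set G}) :
  \sum_(u in S) laplacian h u =
  \sum_(u in S) \sum_(v | sedge u v && (v \notin S)) (h u - h v).
Proof.
have split u : laplacian h u =
    \sum_(v in S | sedge u v) (h u - h v) +
    \sum_(v | sedge u v && (v \notin S)) (h u - h v).
  rewrite /laplacian (bigID (mem S)) /=; congr (_ + _).
  by apply: eq_bigl => v; rewrite andbC.
rewrite (eq_bigr _ (fun u _ => split u)) big_split /=.
suff -> : \sum_(u in S) \sum_(v in S | sedge u v) (h u - h v) = 0 by rewrite add0r.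
under eq_bigr do rewrite sumrB.
rewrite sumrB [X in _ - X](exchange_big_dep (mem S)) /=; last by move=> ? ? _ /andP[].
apply/eqP; rewrite subr_eq0; apply/eqP.
apply: eq_bigr => u uS; apply: eq_bigl => v.
by rewrite uS /= sedge_sym.
Qed.

(** At a minimizer other than j all the differences h(u) - h(v) in the Laplacian
    are nonpositive while their sum is nonnegative, so the neighbours are
    minimizers too; following a path, the minimum is attained at j. *)
Lemma min_principle (R : realDomainType) (G : sgraph) (h : G -> R) (j : G) :
  gconnected G -> (forall i, i != j -> 0 <= laplacian h i) ->
  forall i, h j <= h i.
Proof.
move=> conn sup i; have [k hk] : exists k, forall v, h k <= h v.
  by case: (@arg_minP _ _ _ j predT h isT) => k _ kP; exists k => v; apply: kP.
suff reach p u : path (@sedge G) u p -> j = last u p -> h u = h k -> h j = h k.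
  by have /connectP[p pp jp] := conn k j; rewrite (reach p k).
elim: p u => [|v p IH] u /=; first by move=> _ -> .
move=> /andP[uv pv] jp hu; have [<-//|uj] := eqVneq u j.
apply: (IH v) => //; apply/eqP; rewrite eq_le hk andbT -hu -subr_ge0.
have := sup u uj; rewrite /laplacian (bigD1 v) //= => /le_trans; apply.
by rewrite gerDl sumr_le0 // => w _; rewrite subr_le0 hu.
Qed.

Lemma harmonic_const (R : realDomainType) (G : sgraph) (h : G -> R) :
  gconnected G -> (forall i, laplacian h i = 0) -> forall i j, h i = h j.
Proof.
move=> conn harm i j; apply/eqP; rewrite eq_le.
by rewrite !min_principle // => v _; rewrite harm.
Qed.

Lemma dirichlet_unique (R : realDomainType) (G : sgraph) (h k : G -> R) (j : G) :
  gconnected G -> h j = k j ->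
  (forall i, i != j -> laplacian h i = laplacian k i) -> forall i, h i = k i.
Proof.
move=> conn hk lhk i; apply/eqP; rewrite eq_le -subr_ge0 -[X in _ && X]subr_ge0.
apply/andP; split.
- have := @min_principle _ _ (fun v => k v - h v) j conn _ i.
  by rewrite hk subrr; apply=> v vj; rewrite laplacianB lhk // subrr.
- have := @min_principle _ _ (fun v => h v - k v) j conn _ i.
  by rewrite hk subrr; apply=> v vj; rewrite laplacianB lhk // subrr.
Qed.

(** The map sending h to its Laplacian outside j and to h(j) at j is an injective
    endomorphism of a finite-dimensional space, hence it is onto. *)
Lemma dirichlet_exists (R : realFieldType) (G : sgraph) (f : G -> R) (j : G) :
  gconnected G -> exists2 h : G -> R, h j = 0 &
    forall i, i != j -> laplacian h i = f i.
Proof.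
move=> conn; pose V := {ffun G -> R^o}.
pose phi (h : V) : V := [ffun i => if i == j then h j else laplacian h i : R^o].
have lin : linear phi.
  move=> a h k; apply/ffunP => i; rewrite !ffunE; case: ifP => _ //.
  rewrite /laplacian scaler_sumr -big_split; apply: eq_bigr => v _.
  by rewrite !ffunE /GRing.scale /=; ring.
pose lphi := GRing.isLinear.Build R V V *:%R phi lin.
pose Lphi : {linear V -> V} := HB.pack phi lphi.
have ker0 : lker (linfun Lphi) == 0%VS.
  apply/lker0P => h k; rewrite !lfunE /= => /ffunP e.
  apply/ffunP; apply: (@dirichlet_unique _ _ _ _ j) => //.
    by have := e j; rewrite !ffunE eqxx.
  by move=> i /negPf ij; have := e i; rewrite !ffunE ij.
pose b : V := [ffun i => if i == j then 0 else f i : R^o].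
have := lker0_lfunVK ker0 b; set h := (_^-1)%VF b; rewrite lfunE /= => /ffunP e.
exists h; first by have := e j; rewrite !ffunE eqxx.
by move=> i /negPf ij; have := e i; rewrite !ffunE ij.
Qed.

(** * Mean hitting times solve a Dirichlet problem *)

Lemma degree_gt0 (G : sgraph) (i j : G) :
  gconnected G -> i != j -> (0 < degree i)%N.
Proof.
move=> conn ij; have /connectP[[|v p] /=] := conn i j.
  by move=> _ ji; rewrite ji eqxx in ij.
by move=> /andP[iv _] _; apply/card_gt0P; exists v; rewrite inE.
Qed.

Lemma sum_transition (R : realType) (G : sgraph) (f : G -> R) (i : G) :
  \sum_v transition R i v * f v = (degree i)%:R^-1 * \sum_(v | sedge i v) f v.
Proof.
rewrite mulr_sumr [RHS]big_mkcond /=; apply: eq_bigr => v _.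
by rewrite /transition; case: ifP; rewrite ?mul0r.
Qed.

Lemma transition_ge0 (R : realType) (G : sgraph) (i v : G) :
  0 <= transition R i v.
Proof. by rewrite /transition; case: ifP => // _; rewrite invr_ge0. Qed.

Lemma transition_sum1 (R : realType) (G : sgraph) (i : G) :
  (0 < degree i)%N -> \sum_v transition R i v = 1.
Proof.
move=> d0; have := sum_transition (fun=> 1 : R) i.
under eq_bigr do rewrite mulr1.
by rewrite -degree_sum mulVf // pnatr_eq0 -lt0n.
Qed.

(** First-step equations for the random walk are Laplacian equations multiplied
    by the degree. *)
Lemma laplacian_transition (R : realType) (G : sgraph) (f : G -> R) (i : G) (c : R) :
  (0 < degree i)%N ->
  (f i = \sum_v transition R i v * f v + c) <->
  laplacian f i = (degree i)%:R * c.
Proof.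
move=> d0; have dn0 : (degree i)%:R != 0 :> R by rewrite pnatr_eq0 -lt0n.
rewrite laplacianE sum_transition; split=> [{1}->|/eqP].
  by rewrite mulrDr mulVKf // addrAC subrr add0r.
rewrite subr_eq => /eqP e; apply: (mulfI dn0).
by rewrite mulrDr mulVKf // addrC.
Qed.

Lemma hit_prob0 (R : realType) (G : sgraph) (i j : G) :
  hit_prob R i j 0 = (i == j)%:R.
Proof.
rewrite /hit_prob big_mkcond (bigD1 [tuple]) //= big1 ?addr0.
  by case: (i == j).
by move=> t; rewrite tuple0.
Qed.

Lemma hit_probS (R : realType) (G : sgraph) (i j : G) (t : nat) :
  hit_prob R i j t.+1 =
  if i == j then 0 else \sum_v transition R i v * hit_prob R v j t.
Proof.
rewrite /hit_prob; case: eqP => [->|/eqP /negPf ij].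
  by rewrite big1 // => s /=; rewrite eqxx.
rewrite (reindex (fun p : G * t.-tuple G => [tuple of p.1 :: p.2])) /=; last first.
  exists (fun s : t.+1.-tuple G => (thead s, [tuple of behead s])) => [[v s] _|s _].
    by congr (_, _); apply: val_inj.
  by rewrite [RHS]tuple_eta.
under eq_bigl do rewrite ij eqSS.
under [RHS]eq_bigr do rewrite mulr_sumr.
by rewrite pair_big_dep.
Qed.

Lemma hit_prob_ge0 (R : realType) (G : sgraph) (i j : G) (t : nat) :
  0 <= hit_prob R i j t.
Proof.
elim: t i => [|t IH] i; first by rewrite hit_prob0.
rewrite hit_probS; case: eqP => // _; apply: sumr_ge0 => v _.
by rewrite mulr_ge0 ?transition_ge0.
Qed.

Lemma nneseries_bounded (R : realType) (u : nat -> R) (M : R) :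
  (forall t, 0 <= u t) -> (forall n, \sum_(0 <= t < n) u t <= M) ->
  exists2 l : R, (\sum_(0 <= t < n) u t) @[n --> \oo] --> l &
    (\sum_(0 <= t <oo) (u t)%:E = l%:E)%E.
Proof.
move=> u0 uM; pose s n := \sum_(0 <= t < n) u t.
have cs : cvgn s.
  apply: nondecreasing_is_cvgn; last by exists M => _ [n _ <-]; exact: uM.
  by move=> m n mn; rewrite /s (big_cat_nat (leq0n _) mn) //= lerDl sumr_ge0.
exists (limn s) => //; rewrite -EFin_lim //; congr (limn _).
by apply/funext => n; rewrite /= sumEFin.
Qed.

Lemma cvg_succ_unique (R : realType) (u : nat -> R) (l m : R) :
  u n @[n --> \oo] --> l -> u n.+1 @[n --> \oo] --> m -> l = m.
Proof.
rewrite -(cvg_shiftS u) => ul um.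
exact: (@cvg_unique _ (@Rhausdorff R) _ _ _ _ ul um).
Qed.

Section MeanHittingTime.
Variables (R : realType) (G : sgraph) (j : G).
Hypothesis conn : gconnected G.
Let P := transition R.
Let p t i := hit_prob R i j t.

Lemma sum_hit_probS i n : i != j ->
  \sum_(0 <= t < n.+1) p t i = \sum_v P i v * \sum_(0 <= t < n) p t v.
Proof.
move=> ij; rewrite big_nat_recl // {1}/p hit_prob0 (negPf ij) add0r.
under eq_bigr do rewrite /p hit_probS (negPf ij).
by rewrite exchange_big; apply: eq_bigr => v _; rewrite mulr_sumr.
Qed.

(** The shift from time t to t + 1 is what adds the sum of probabilities. *)
Lemma sum_time_hit_probS i n : i != j ->
  \sum_(0 <= t < n.+1) t%:R * p t i =
  \sum_v P i v * (\sum_(0 <= t < n) t%:R * p t v + \sum_(0 <= t < n) p t v).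
Proof.
move=> ij; rewrite big_nat_recl // mul0r add0r.
under eq_bigr do rewrite /p hit_probS (negPf ij) mulr_sumr.
rewrite exchange_big; apply: eq_bigr => v _.
rewrite -big_split mulr_sumr; apply: eq_bigr => t _ /=.
by rewrite /p /P -(natr1 t); ring.
Qed.

Lemma hit_probS_target t : p t.+1 j = 0.
Proof. by rewrite /p hit_probS eqxx. Qed.

Lemma sum_hit_prob_le1 n i : \sum_(0 <= t < n) p t i <= 1.
Proof.
elim: n i => [|n IH] i; first by rewrite big_geq.
have [->|ij] := eqVneq i j.
  rewrite big_nat_recl // /p hit_prob0 eqxx big1 ?addr0 // => t _.
  exact: hit_probS_target.
rewrite sum_hit_probS // -(transition_sum1 R (degree_gt0 conn ij)).
by apply: ler_sum => v _; rewrite ler_piMr ?transition_ge0.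
Qed.

(** First-step recurrences on partial sums become first-step equations for their
    limits. *)
Lemma cvg_first_step (f : nat -> G -> R) (g : nat -> G -> R) (l m : G -> R) i :
  (forall n, f n.+1 i = \sum_v P i v * g n v) ->
  f n i @[n --> \oo] --> l i -> (forall v, g n v @[n --> \oo] --> m v) ->
  l i = \sum_v P i v * m v.
Proof.
move=> fg fl gm; apply: (cvg_succ_unique fl).
rewrite (funext fg); apply: cvg_big; first exact: add_continuous.
by move=> v _; apply: cvgM; [exact: cvg_cst|exact: gm].
Qed.

(** By induction on n, the partial sums of the expectation stay below h, the
    first-step equation of h supplying the induction step; so both series
    converge.  Their limits satisfy first-step equations: the limit of the
    probabilities is harmonic outside j with value 1 at j, hence is 1 (the walk
    reaches j almost surely), and then the limit of the expectations solves the
    same Dirichlet problem as h. *)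
Lemma mean_hitting_timeP (h : G -> R) : h j = 0 ->
  (forall i, i != j -> laplacian h i = (degree i)%:R) ->
  forall i, mean_hitting_time R i j = (h i)%:E.
Proof.
move=> hj hlap.
have step i : i != j -> h i = \sum_v P i v * h v + 1.
  move=> ij; apply/laplacian_transition; first exact: degree_gt0 conn ij.
  by rewrite mulr1 hlap.
have h0 i : 0 <= h i.
  by rewrite -hj; apply: min_principle => // v vj; rewrite hlap.
have time_le n i : \sum_(0 <= t < n) t%:R * p t i <= h i.
  elim: n i => [|n IH] i; first by rewrite big_geq.
  have [->|ij] := eqVneq i j.
    rewrite big_nat_recl // mul0r add0r big1 ?hj // => t _.
    by rewrite hit_probS_target mulr0.
  rewrite sum_time_hit_probS // step //.
  rewrite -[X in _ <= _ + X](transition_sum1 R (degree_gt0 conn ij)) -big_split /=.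
  apply: ler_sum => v _; rewrite -[X in _ <= _ + X]mulr1 -mulrDr ler_wpM2l ?transition_ge0 //.
  by apply: lerD; [exact: IH|exact: sum_hit_prob_le1].
have tp_ge0 i t : 0 <= t%:R * p t i by rewrite mulr_ge0 // hit_prob_ge0.
have [B BE BoE] : exists2 B : G -> R,
    (forall i, (\sum_(0 <= t < n) p t i) @[n --> \oo] --> B i) &
    (forall i, (\sum_(0 <= t <oo) (p t i)%:E = (B i)%:E)%E).
  have ex i := nneseries_bounded (fun t => hit_prob_ge0 R i j t)
    (fun n => sum_hit_prob_le1 n i).
  by exists (fun i => s2val (cid2 (ex i))) => i; case: cid2.
have [A AE AoE] : exists2 A : G -> R,
    (forall i, (\sum_(0 <= t < n) t%:R * p t i) @[n --> \oo] --> A i) &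
    (forall i, (\sum_(0 <= t <oo) (t%:R * p t i)%:E = (A i)%:E)%E).
  have ex i := nneseries_bounded (tp_ge0 i) (time_le^~ i).
  by exists (fun i => s2val (cid2 (ex i))) => i; case: cid2.
have B1 i : B i = 1.
  apply: (@dirichlet_unique _ _ B (fun=> 1) j conn) => [|k kj].
    apply: (cvg_succ_unique (BE j)).
    rewrite (_ : (fun _ => _) = fun=> 1); first exact: cvg_cst.
    apply/funext => n; rewrite big_nat_recl // /p hit_prob0 eqxx big1 ?addr0 // => t _.
    exact: hit_probS_target.
  rewrite [RHS]laplacianE mulr1 -degree_sum subrr -[RHS](mulr0 (degree k)%:R).
  apply/laplacian_transition; first exact: degree_gt0 conn kj.
  rewrite addr0; apply: (cvg_first_step (f := fun n v => \sum_(0 <= t < n) p t v)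
    (l := B) _ (BE k) BE) => n.
  exact: sum_hit_probS.
have Ah i : A i = h i.
  apply: (@dirichlet_unique _ _ A h j conn) => [|k kj].
    rewrite hj; apply: (cvg_succ_unique (AE j)).
    rewrite (_ : (fun _ => _) = fun=> 0); first exact: cvg_cst.
    apply/funext => n; rewrite big_nat_recl // mul0r add0r big1 // => t _.
    by rewrite hit_probS_target mulr0.
  rewrite hlap // -[RHS]mulr1.
  apply/laplacian_transition; first exact: degree_gt0 conn kj.
  rewrite -[X in _ = _ + X](transition_sum1 R (degree_gt0 conn kj)) -big_split /=.
  under [RHS]eq_bigr do rewrite -[X in _ + X]mulr1 -mulrDr.
  apply: (cvg_first_step (f := fun n v => \sum_(0 <= t < n) t%:R * p t v)
    (l := A) (m := fun v => A v + 1) _ (AE k)) => [n|v].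
    exact: sum_time_hit_probS.
  rewrite (_ : A v + 1 = A v + B v); last by rewrite B1.
  by apply: cvgD; [exact: AE|exact: BE].
by move=> i; rewrite /mean_hitting_time AoE BoE B1 Ah subee // mule0 adde0.
Qed.

End MeanHittingTime.

(** * Hitting times and Kemeny's constant *)

Definition hitting (R : realType) (G : sgraph) (j i : G) : R :=
  fine (mean_hitting_time R i j).

Section Hitting.
Variables (R : realType) (G : sgraph).
Hypothesis conn : gconnected G.
Let hit := @hitting R G.
Let vol : R := 2 * (nedges G)%:R.

Lemma volE : vol = \sum_(u : G) (degree u)%:R.
Proof. by rewrite /vol -natrM -sum_degree natr_sum. Qed.

Lemma mean_hitting_time_fin i j : mean_hitting_time R i j = (hit j i)%:E.
Proof.
have [h hj hlap] := dirichlet_exists (fun i => (degree i)%:R : R) j conn.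
by rewrite /hit /hitting (mean_hitting_timeP conn hj hlap).
Qed.

Lemma hitting_dirichlet j :
  hit j j = 0 /\ forall i, i != j -> laplacian (hit j) i = (degree i)%:R.
Proof.
have [h hj hlap] := dirichlet_exists (fun i => (degree i)%:R : R) j conn.
have -> : hit j = h.
  by apply/funext => i; rewrite /hit /hitting (mean_hitting_timeP conn hj hlap).
by [].
Qed.

Lemma hitting_diag j : hit j j = 0.
Proof. by case: (hitting_dirichlet j). Qed.

Lemma laplacian_hitting j i : i != j -> laplacian (hit j) i = (degree i)%:R.
Proof. by case: (hitting_dirichlet j) => _; apply. Qed.

Lemma hitting_ge0 j i : 0 <= hit j i.
Proof.
rewrite -(hitting_diag j); apply: min_principle => // v vj.
by rewrite laplacian_hitting.
Qed.

(** The Laplacians over the whole graph sum to 0, which fixes the value at j. *)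
Lemma laplacian_hitting_diag j : laplacian (hit j) j = (degree j)%:R - vol.
Proof.
have := sum_laplacian (hit j) [set: G]%SET.
rewrite [RHS]big1 => [|u _]; last first.
  by rewrite big1 // => v; rewrite inE andbF.
rewrite (eq_bigl predT) => [|u]; last by rewrite inE.
rewrite (bigD1 j) //= (eq_bigr (fun u => (degree u)%:R)) => [|u]; last first.
  exact: laplacian_hitting.
by rewrite volE [X in _ = _ - X](bigD1 j) //=; move: (\sum_(_ | _) _) => s; lra.
Qed.

(** At i, the terms j other than i contribute deg(j) deg(i) / vol each, and the
    term j = i contributes deg(i) (deg(i) - vol) / vol; the degrees sum to vol. *)
Lemma laplacian_kemeny i :
  laplacian (fun i => \sum_j (degree j)%:R / vol * hit j i) i = 0.
Proof.
transitivity (\sum_j (degree j)%:R / vol * laplacian (hit j) i).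
  rewrite /laplacian; under [RHS]eq_bigr do rewrite mulr_sumr.
  rewrite [RHS]exchange_big; apply: eq_bigr => v _ /=.
  by rewrite -sumrB; apply: eq_bigr => j _; rewrite mulrBr.
rewrite (bigD1 i) //= laplacian_hitting_diag.
under eq_bigr => j ji do rewrite laplacian_hitting 1?eq_sym //.
rewrite -!mulr_suml.
have := volE; rewrite (bigD1 i) //=; move: (\sum_(_ | _) _) => s ->.
by ring.
Qed.

(** By harmonicity the starting vertex is irrelevant; the term j = i, absent from
    the definition, may be included because it is 0. *)
Lemma fine_kemeny i :
  fine (kemeny R G) = \sum_j (degree j)%:R / vol * hit j i.
Proof.
have from k : kemeny_from R k = (\sum_j (degree j)%:R / vol * hit j k)%:E.
  rewrite /kemeny_from [in RHS](bigD1 k) //= hitting_diag mulr0 add0r -sumEFin.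
  by apply: eq_bigr => j _; rewrite mean_hitting_time_fin.
rewrite /kemeny (@xget_unique _ _ _ (\sum_j (degree j)%:R / vol * hit j i)%:E) //.
  move=> k; rewrite from; congr EFin.
  exact: (harmonic_const conn laplacian_kemeny).
by move=> _ /(_ i) <-.
Qed.

Lemma fine_kemeny_le M : G -> 0 <= M -> (forall i j, hit j i <= M) ->
  fine (kemeny R G) <= M.
Proof.
move=> i M0 hM; rewrite (fine_kemeny i).
apply: (@le_trans _ _ (\sum_j (degree j)%:R / vol * M)).
  by apply: ler_sum => j _; rewrite ler_wpM2l // divr_ge0 // /vol mulr_ge0.
rewrite -mulr_suml -mulr_suml -volE.
by have [->|v0] := eqVneq vol 0; rewrite ?mul0r // divff // mul1r.
Qed.

(** The superlevel set S of the values at least h(i) does not contain j.  The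
    flow out of S is the sum of the degrees in S, at most vol; all its terms are
    nonnegative and h(i) - h(v) is one of them. *)
Lemma hitting_adjacent j i v : sedge i v -> hit j i - hit j v <= vol.
Proof.
move=> iv; have vol0 : 0 <= vol by rewrite /vol mulr_ge0.
have [le|lt] := lerP (hit j i) (hit j v).
  by apply: le_trans vol0; rewrite subr_le0.
pose S := [set u | hit j i <= hit j u]%SET.
have jS : j \notin S.
  by rewrite inE -ltNge hitting_diag (le_lt_trans _ lt) // hitting_ge0.
have pos u w : u \in S -> w \notin S -> 0 <= hit j u - hit j w.
  rewrite !inE -ltNge subr_ge0 => uS wS; exact: le_trans (ltW wS) uS.
have := sum_laplacian (hit j) S.
rewrite (bigD1 i) /=; last by rewrite inE.
rewrite [in RHS](bigD1 i) /=; last by rewrite inE.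
rewrite [in RHS](bigD1 v) /=; last by rewrite iv inE -ltNge.
have -> : laplacian (hit j) i + \sum_(u in S | u != i) laplacian (hit j) u =
    \sum_(u in S) (degree u)%:R.
  rewrite -(bigD1 i (P := mem S)) ?inE //; apply: eq_bigr => u uS.
  by rewrite laplacian_hitting //; apply: contraNneq jS => <-.
move=> e; apply: (@le_trans _ _ (\sum_(u in S) (degree u)%:R)).
  rewrite e -addrA lerDl addr_ge0 //.
    apply: sumr_ge0 => w /andP[/andP[_ wS] _]; apply: pos => //.
    by rewrite inE.
  apply: sumr_ge0 => u /andP[uS _]; apply: sumr_ge0 => w /andP[_ wS].
  exact: pos.
by rewrite volE [leRHS](bigID (mem S)) /= lerDl sumr_ge0.
Qed.

(** Add up the drops along a simple path from i to j. *)
Lemma hitting_le j i : hit j i <= vol * (nvertices G)%:R.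
Proof.
have vol0 : 0 <= vol by rewrite /vol mulr_ge0.
have /connectP[q qp ->] := conn i j.
case: (shortenP qp) => p pp up _ {q qp}.
have : hit (last i p) i <= vol * (size p)%:R.
  elim: p i pp {up} => [|v p IH] i /=; first by rewrite hitting_diag mulr0.
  move=> /andP[iv pv]; have := IH v pv.
  have := hitting_adjacent (last v p) iv; rewrite -natr1 mulrDr mulr1.
  by move: (hit _ _) (hit _ _) (vol * _) => a b c; lra.
move=> /le_trans; apply; rewrite ler_wpM2l // ler_nat.
have /card_uniqP := up; rewrite /= => e; apply: leq_trans (max_card (mem (i :: p))).
by rewrite e.
Qed.

Lemma vol_le_sqr : vol <= (nvertices G)%:R ^+ 2.
Proof.
rewrite volE expr2 -natrM -natr_sum ler_nat /nvertices -sum_nat_const.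
by apply: leq_sum => u _; apply: max_card.
Qed.

(** When S is attached to the rest by the single edge ab, the whole flow out of S
    goes through that edge. *)
Lemma bridge_drop j (S : {set G}) a b : j \notin S -> a \in S -> b \notin S ->
  sedge a b -> (forall u v, u \in S -> v \notin S -> sedge u v -> u = a /\ v = b) ->
  hit j a - hit j b = \sum_(u in S) (degree u)%:R.
Proof.
move=> jS aS bS ab cut.
have -> : \sum_(u in S) (degree u)%:R = \sum_(u in S) laplacian (hit j) u.
  by apply: eq_bigr => u uS; rewrite laplacian_hitting //; apply: contraNneq jS => <-.
rewrite sum_laplacian (bigD1 a) //= [X in _ = _ + X]big1 ?addr0 => [|u /andP[uS ua]].
  rewrite (bigD1 b) /= ?ab // big1 ?addr0 // => v /andP[/andP[av vS] vb].
  by have [_ vb'] := cut a v aS vS av; rewrite vb' eqxx in vb.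
rewrite big1 // => v /andP[uv vS].
by have [ua' _] := cut u v uS vS uv; rewrite ua' eqxx in ua.
Qed.

(** Let M be the maximum of h.  Among the neighbours w of a vertex v, the target
    contributes 0 instead of at most M, so h(v) <= 1 + M - M / n whenever v ~ j.
    At the maximizer k at least c neighbours v enjoy this gain, and the
    first-step equation there gives c M / n <= 2 deg(k) <= 2 n. *)
Lemma hitting_le_common (c : nat) j i : (0 < c)%N ->
  (forall u v : G, (c <= #|[set w | sedge u w && sedge w v]%SET|)%N) ->
  hit j i <= 2 * (nvertices G)%:R ^+ 2 / c%:R.
Proof.
move=> c0 common; set n : R := (nvertices G)%:R.
have n0 : 0 < n by rewrite ltr0n; apply/card_gt0P; exists j.
have cR0 : (0 : R) < c%:R by rewrite ltr0n.
have degn (u : G) : (degree u)%:R <= n by rewrite ler_nat max_card.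
have [k hk] : exists k, forall v, hit j v <= hit j k.
  by case: (@arg_maxP _ _ _ j predT (hit j) isT) => k _ kP; exists k => v; apply: kP.
apply: le_trans (hk i) _.
have [->|kj] := eqVneq k j.
  by rewrite hitting_diag divr_ge0 // ?mulr_ge0 ?sqr_ge0 ?ltW.
set M := hit j k; have M0 : 0 <= M by apply: hitting_ge0.
have one_step u : u != j ->
    (degree u)%:R * hit j u = (degree u)%:R + \sum_(w | sedge u w) hit j w.
  by move=> uj; have := laplacian_hitting uj; rewrite laplacianE; lra.
have bound v : hit j v <= 1 + M - (sedge v j)%:R * (M / n).
  have [->|vj] := eqVneq v j.
    by rewrite hitting_diag sedge_irr mul0r subr0 addr_ge0.
  have dv0 : (0 : R) < (degree v)%:R by rewrite ltr0n (degree_gt0 conn vj).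
  have sumle : \sum_(w | sedge v w) hit j w <=
      (degree v)%:R * M - (sedge v j)%:R * M.
    rewrite degree_sum mulr_suml; case vjE: (sedge v j); last first.
      by rewrite mul0r subr0; apply: ler_sum => w _; rewrite mul1r hk.
    rewrite (bigD1 j) //= hitting_diag add0r [X in _ <= X - _](bigD1 j) //=.
    rewrite addrAC subrr add0r; apply: ler_sum => w _.
    by rewrite mul1r hk.
  have step : hit j v <= 1 + M - (sedge v j)%:R * (M / (degree v)%:R).
    rewrite -(ler_pM2l dv0) one_step //.
    rewrite (_ : _ * (1 + M - _) = (degree v)%:R + ((degree v)%:R * M - (sedge v j)%:R * M)); last first.
      by field; rewrite gt_eqF.
    by rewrite lerD2l.
  apply: le_trans step _; rewrite lerD2l lerN2 ler_wpM2l // ler_wpM2l //.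
  by rewrite lef_pV2 // posrE.
have key : c%:R * (M / n) <= 2 * n.
  have := one_step k kj; rewrite -/M => e.
  have : \sum_(w | sedge k w) hit j w <= (degree k)%:R * (1 + M) - c%:R * (M / n).
    apply: (@le_trans _ _ (\sum_(w | sedge k w) (1 + M - (sedge w j)%:R * (M / n)))).
      by apply: ler_sum => w _; apply: bound.
    rewrite sumrB -mulr_suml.
    under eq_bigr do rewrite -[1 + M]mul1r.
    rewrite -mulr_suml -degree_sum lerD2l lerN2 ler_wpM2r ?divr_ge0 ?(ltW n0) //.
    rewrite -natr_sum ler_nat; apply: leq_trans (common k j) _.
    by rewrite -sum1dep_card big_mkcondr.
  have := degn k; have : 0 <= (degree k)%:R :> R by [].
  by move: (c%:R * (M / n)) (\sum_(_ | _) _) e => a s e; nra.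
rewrite ler_pdivlMr // mulrC.
have -> : c%:R * M = c%:R * (M / n) * n by field; rewrite gt_eqF.
by rewrite expr2 [2 * _]mulrA ler_wpM2r // ltW.
Qed.

(** The function equal to e outside j and to 0 at j has Laplacian e at the
    neighbours of j and 0 at the remaining vertices, never more than the degree,
    so it lies below the hitting time by the minimum principle. *)
Lemma hitting_ge_degree (e : nat) j i : (forall u : G, (e <= degree u)%N) ->
  i != j -> e%:R <= hit j i.
Proof.
move=> dege ij; pose g (v : G) : R := (v != j)%:R * e%:R.
have := @min_principle _ _ (fun v => hit j v - g v) j conn _ i.
rewrite /g ij eqxx mul0r mul1r hitting_diag subrr subr_ge0; apply=> u uj.
rewrite laplacianB laplacian_hitting // subr_ge0 laplacianE uj mul1r -mulr_suml.
rewrite -mulrBl degree_sum -sumrB.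
have -> : \sum_(w | sedge u w) (1 - (w != j)%:R) = (sedge u j)%:R :> R.
  rewrite big_mkcond (bigD1 j) //= eqxx big1 => [|w ->].
    by rewrite subr0 addr0; case: ifP.
  by rewrite subrr; case: ifP.
rewrite -degree_sum; case: (sedge u j); last by rewrite mul0r.
by rewrite mul1r ler_nat.
Qed.

(** The n - 1 targets j have stationary weight at least e / (n (n - 1)) and
    hitting time at least e. *)
Lemma fine_kemeny_ge_degree (e : nat) : (0 < e)%N ->
  (forall u : G, (e <= degree u)%N) -> (1 < nvertices G)%N ->
  e%:R ^+ 2 / (nvertices G)%:R <= fine (kemeny R G).
Proof.
move=> e0 dege n1; have /card_gt0P[i _] : (0 < #|G|)%N by apply: ltnW.
rewrite (fine_kemeny i); set n := nvertices G.
have eR0 : (0 : R) < e%:R by rewrite ltr0n.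
have nR0 : (0 : R) < n%:R by rewrite ltr0n ltnW.
have n1R0 : (0 : R) < n.-1%:R by rewrite ltr0n -ltnS prednK // ltnW.
have vol_le : vol <= n%:R * n.-1%:R.
  rewrite volE -natrM -natr_sum ler_nat /n /nvertices -sum_nat_const.
  apply: leq_sum => u _; rewrite /degree -ltnS prednK; last exact: ltnW.
  apply: (@leq_ltn_trans #|[set~ u]%SET|); last by rewrite cardsC1 prednK // ltnW.
  apply: subset_leq_card; apply/fintype.subsetP => v; rewrite !inE => uv.
  by apply: contraTneq uv => ->; rewrite sedge_irr.
have vol0 : 0 < vol.
  rewrite volE (bigD1 i) //= ltr_pwDl // ?ltr0n ?(leq_trans e0) //.
  exact: sumr_ge0.
apply: (@le_trans _ _ (\sum_(j | j != i) e%:R / vol * e%:R)); last first.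
  rewrite [leRHS](bigD1 i) //= hitting_diag mulr0 add0r; apply: ler_sum => j ji.
  have d : e%:R <= (degree j)%:R :> R by rewrite ler_nat.
  have v' : 0 <= vol^-1 by rewrite invr_ge0 ltW.
  apply: ler_pM; rewrite ?ler0n ?mulr_ge0 ?ler0n //; first exact: ler_wpM2r.
  by apply: hitting_ge_degree => //; rewrite eq_sym.
have card : #|predC1 i| = n.-1 by rewrite /n /nvertices (cardC1 i).
rewrite (eq_bigl (mem (predC1 i))) // sumr_const card.
rewrite -[leRHS]mulr_natr ler_pdivrMr //.
rewrite [leRHS](_ : _ = e%:R ^+ 2 * ((n%:R * n.-1%:R) / vol)); last by ring.
by rewrite ler_peMr ?sqr_ge0 // ler_pdivlMr // mul1r.
Qed.

End Hitting.

(** * Dense graphs and complements *)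

Section Dense.
Variable G : sgraph.

Lemma complement_degree (u : G) :
  (@degree (complement G) u + (degree u).+1 = nvertices G)%N.
Proof.
rewrite /nvertices /degree -(cardsC (u |: [set v | sedge u v]%SET)%SET).
rewrite cardsU1 inE sedge_irr /= addnC add1n; congr (_.+1 + _)%N.
apply: eq_card => v.
by rewrite !inE /= /compl_edge negb_or eq_sym.
Qed.

Lemma common_neighbours (e : nat) : (forall u : G, (e <= degree u)%N) ->
  forall u v : G,
    (2 * e - nvertices G <= #|[set w | sedge u w && sedge w v]%SET|)%N.
Proof.
move=> dege u v.
have -> : [set w | sedge u w && sedge w v]%SET =
    ([set w | sedge u w] :&: [set w | sedge v w])%SET.
  by apply/setP => w; rewrite !inE [sedge w v]sedge_sym.
have := finset.cardsUI [set w | sedge u w]%SET [set w | sedge v w]%SET.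
have := max_card (mem ([set w | sedge u w] :|: [set w | sedge v w])%SET).
have := dege u; have := dege v; rewrite /degree /nvertices.
by move: #|_| #|_| #|_| #|_| #|_| => a b c k l; lia.
Qed.

Lemma common_neighbours_connected :
  (forall u v : G, (0 < #|[set w | sedge u w && sedge w v]%SET|)%N) ->
  gconnected G.
Proof.
move=> common u v; have /card_gt0P[w] := common u v.
by rewrite inE => /andP[uw wv]; apply: connect_trans (connect1 uw) (connect1 wv).
Qed.

End Dense.

(** * Chains with two large ends *)

(** The chain has d = e + 2 pieces, e of them being single vertices. *)
Section ChainGraph.
Variables (e : nat) (H : nat -> sgraph) (x y : forall i, H i).
Let d := e.+2.
Let G := chain d x y.
Hypothesis Hconn : forall i, (i < d)%N -> gconnected (H i).
Hypothesis H_ends : nvertices (H 0) = d /\ nvertices (H d.-1) = d.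
Hypothesis H_mid : forall i, (0 < i < d.-1)%N -> nvertices (H i) = 1%N.

Definition in_piece (i : 'I_d) (a : H i) : G := Tagged (fun k : 'I_d => H k) a.

Lemma in_piece_edge (i : 'I_d) (a b : H i) :
  sedge (in_piece a) (in_piece b) = sedge a b.
Proof.
rewrite /in_piece /= /chain_edge /bridge /= eqxx /=.
pose T (k : 'I_d) : Type := H k.
rewrite (tagged_asE (T_ := T) (u := Tagged T a)).
by rewrite eqn_leq ltnn /= !orbF.
Qed.

Lemma bridge_edge (i k : 'I_d) : k = i.+1 :> nat ->
  sedge (in_piece (x i)) (in_piece (y k)).
Proof. by move=> ki; rewrite /= /chain_edge /bridge /= -ki !eqxx /= orbT. Qed.

Lemma piece_connect (i : 'I_d) (a b : H i) :
  connect (@sedge G) (in_piece a) (in_piece b).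
Proof.
have /connectP[p pp ->] := Hconn (ltn_ord i) a b.
elim: p a pp => [|c p IH] a /=; first by rewrite connect0.
move=> /andP[ac pc]; apply: connect_trans (IH c pc); apply: connect1.
by rewrite in_piece_edge.
Qed.

Lemma chain_connected : gconnected G.
Proof.
have from0 k (i : 'I_d) (a : H i) : i = k :> nat ->
    connect (@sedge G) (in_piece (x (ord0 : 'I_d))) (in_piece a).
  elim: k i a => [|k IH] i a ik.
    have i0 : i = ord0 by apply: val_inj.
    by case: _ / (esym i0) a ik => a _; apply: piece_connect.
  have kd : (k < d)%N by apply: ltnW; rewrite -ik.
  apply: connect_trans (IH (Ordinal kd) (x k) erefl) _.
  apply: connect_trans (piece_connect (y i) a).
  by apply: connect1; apply: (@bridge_edge (Ordinal kd)).
move=> [i a] [k b]; apply: (@connect_trans _ _ (in_piece (x (ord0 : 'I_d)))).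
  by rewrite (sym_connect_sym (@sedge_sym G)); apply: from0.
exact: from0.
Qed.

Lemma chain_nvertices : nvertices G = (3 * e + 4)%N.
Proof.
rewrite /nvertices card_tagged sumnE big_map big_enum /= big_ord_recl big_ord_recr /=.
have [h0 hd] := H_ends; move: h0 hd; rewrite /nvertices /= => -> ->.
rewrite (eq_bigr (fun=> 1%N)) ?sum1_card ?card_ord => [|i _]; last first.
  by apply: H_mid; rewrite /= /bump /= ltnS ltn_ord.
by rewrite /d; lia.
Qed.

Lemma piece_le (i : 'I_d) : (nvertices (H i) <= d)%N.
Proof.
have [h0 hd] := H_ends.
have [i0|i0] := posnP i; first by rewrite i0 h0.
have [il|] := ltnP i d.-1; first by rewrite H_mid ?i0.
move=> di; have -> : nat_of_ord i = d.-1 by have := ltn_ord i; lia.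
by rewrite hd.
Qed.

Lemma in_piece_tag (u : G) (i : 'I_d) : tag u = i -> exists a : H i, u = in_piece a.
Proof. by case: u => k a /= <-; exists a. Qed.

(** A vertex has its neighbours in its own piece, and at most one along each of
    the two bridges. *)
Lemma chain_degree (u : G) : (degree u <= d.+2)%N.
Proof.
pose S := [set v : G | tag v == tag u]%SET.
pose B1 := [set v : G | bridge x y u v]%SET.
pose B2 := [set v : G | bridge x y v u]%SET.
have sub : [set v | sedge u v]%SET \subset (S :|: (B1 :|: B2))%SET.
  apply/fintype.subsetP => v; rewrite !inE /= /chain_edge eq_sym.
  by case/or3P => [/andP[-> _]|->|->]; rewrite ?orbT.
have cS : (#|S| <= d)%N.
  apply: leq_trans (piece_le (tag u)).
  apply: (@leq_trans #|[set @in_piece (tag u) a | a in [set: H (tag u)]]%SET|).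
    apply: subset_leq_card; apply/fintype.subsetP => v; rewrite inE => /eqP tv.
    by have [a ->] := in_piece_tag tv; apply: imset_f.
  by rewrite /nvertices -cardsT leq_imset_card.
have cB1 : (#|B1| <= 1)%N.
  apply/card_le1_eqP => -[i a] [k b]; rewrite !inE /bridge /=.
  case/and3P => /eqP ui _ /eqP -> /and3P[/eqP uk _ /eqP ->].
  have ik : i = k by apply: val_inj; rewrite /= -ui.
  by case: _ / ik b.
have cB2 : (#|B2| <= 1)%N.
  apply/card_le1_eqP => -[i a] [k b]; rewrite !inE /bridge /=.
  case/and3P => /eqP ui /eqP -> _ /and3P[/eqP uk /eqP -> _].
  have ik : i = k by apply: val_inj; apply: succn_inj; rewrite /= ui.
  by case: _ / ik b.
rewrite /degree; apply: leq_trans (subset_leq_card sub) _.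
have := finset.cardsUI S (B1 :|: B2)%SET; have := finset.cardsUI B1 B2.
move: cS cB1 cB2; clear.
by move: #|_| #|_| #|_| #|_| #|_| #|_| #|_| => *; lia.
Qed.

Lemma piece_degree_sum (S : {set G}) (i : 'I_d) :
  (forall u : G, tag u = i -> u \in S) ->
  (2 * nedges (H i) <= \sum_(u in S) degree u)%N.
Proof.
move=> iS; rewrite -sum_degree.
have inj : injective (@in_piece i).
  move=> a b; pose T (k : 'I_d) : Type := H k.
  move=> /(congr1 (tagged_as (Tagged T a))).
  by rewrite (tagged_asE (T_ := T) (u := Tagged T a) a)
    (tagged_asE (T_ := T) (u := Tagged T a) b).
apply: (@leq_trans (\sum_(a : H i) degree (in_piece a))).
  apply: leq_sum => a _; rewrite /degree.
  rewrite -(card_imset _ inj); apply: subset_leq_card.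
  apply/fintype.subsetP => _ /imsetP[b + ->]; rewrite !inE.
  by rewrite in_piece_edge.
rewrite -(big_imset (h := @in_piece i) (A := mem (H i)) (fun u => degree u)) /=; last first.
  by move=> a b _ _; apply: inj.
rewrite [leqRHS](bigID (mem [set in_piece a | a in H i]%SET)) /=.
apply: leq_trans (leq_addr _ _).
rewrite [leqRHS](eq_bigl (mem [set in_piece a | a in H i]%SET)) // => u.
rewrite andb_idl // => /imsetP[a _ ->]; exact: iS.
Qed.

Variable R : realType.

(** The pieces up to i are separated from the last one by a single bridge, and
    they contain the first piece. *)
Lemma bridge_hitting_drop (j : G) (i k : 'I_d) :
  k = i.+1 :> nat -> tag j = ord_max ->
  2 * (nedges (H 0))%:R <=
    hitting R j (in_piece (x i)) - hitting R j (in_piece (y k)).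
Proof.
move=> ki jmax; pose S := [set u : G | tag u <= i]%N%SET.
rewrite (@bridge_drop R G chain_connected j S).
- rewrite -natr_sum -natrM ler_nat (@piece_degree_sum S ord0) // => u u0.
  by rewrite inE u0.
- by rewrite inE jmax -ltnNge -ltnS -ki.
- by rewrite inE.
- by rewrite inE /= -ltnNge ki.
- exact: bridge_edge.
move=> u v; rewrite !inE -ltnNge /= /chain_edge => ui vi.
case/or3P.
- by case/andP => /eqP uv; rewrite -uv ltnNge ui in vi.
- case: u v ui vi => [a u] [b v] /= ui vi; rewrite /bridge /=.
  case/and3P => /eqP ab /eqP -> /eqP ->.
  have ai : a = i by apply: val_inj => /=; lia.
  have bk : b = k by apply: val_inj => /=; lia.
  by subst a b.
- by case/and3P => /eqP vu _ _; move: ui; rewrite -vu => /ltnW; rewrite leqNgt vi.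
Qed.

(** In a single-vertex piece the two bridge ends coincide, so the drops at the
    e + 1 bridges add up. *)
Lemma hitting_across_chain (j : G) : tag j = ord_max ->
  2 * (nedges (H 0))%:R * e.+1%:R <= hitting R j (in_piece (x (ord0 : 'I_d))).
Proof.
move=> jmax; set m := 2 * _.
have walk k : (k <= e)%N -> m * k%:R + hitting R j (in_piece (x (inord k : 'I_d)))
    <= hitting R j (in_piece (x (ord0 : 'I_d))).
  elim: k => [|k IH] ke.
    by rewrite mulr0 add0r (_ : inord 0 = ord0) //; apply: val_inj; rewrite /= inordK.
  have kS : (inord k.+1 : 'I_d) = (inord k : 'I_d).+1 :> nat.
    by rewrite !inordK // ltnS ltnW // ltnW.
  have := bridge_hitting_drop kS jmax; rewrite -/m.
  have -> : y (inord k.+1 : 'I_d) = x (inord k.+1 : 'I_d).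
    apply: (@card_le1_eqP _ (mem (H (inord k.+1 : 'I_d))) _) => //.
    by rewrite -[X in (X <= _)%N]/(nvertices _) H_mid // inordK // ltnS ltnW.
  have := IH (ltnW ke); rewrite -(natr1 k) mulrDr mulr1.
  by move: (m * _) (hitting _ _ _) (hitting _ _ _) (hitting _ _ _) => *; lra.
have last : (ord_max : 'I_d) = (inord e : 'I_d).+1 :> nat by rewrite inordK.
have := bridge_hitting_drop last jmax; rewrite -/m.
have := hitting_ge0 R chain_connected j (in_piece (y (ord_max : 'I_d))).
have := walk e (leqnn e); rewrite -(natr1 e) mulrDr mulr1.
by move: (m * _) (hitting _ _ _) (hitting _ _ _) (hitting _ _ _) => *; lra.
Qed.

(** Start in the first piece and keep only the targets in the last one. *)
Lemma chain_kemeny_ge :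
  4 * (nedges (H 0))%:R * (nedges (H d.-1))%:R * e.+1%:R / (nvertices G)%:R ^+ 2
    <= fine (kemeny R G).
Proof.
rewrite (fine_kemeny R chain_connected (in_piece (x (ord0 : 'I_d)))).
set vol := 2 * _; set m0 : R := (nedges (H 0))%:R; set m1 : R := (nedges _)%:R.
pose S := [set u : G | tag u == ord_max]%SET.
have vol0 : 0 < vol.
  rewrite /vol -natrM ltr0n -sum_degree (bigD1 (in_piece (x (ord0 : 'I_d)))) //=.
  rewrite addn_gt0 (@degree_gt0 _ _ (in_piece (x (ord_max : 'I_d)))) //.
  exact: chain_connected.
have m0_ge0 : 0 <= m0 by [].
have deg_ge : 2 * m1 <= \sum_(u in S) (degree u)%:R :> R.
  rewrite -natrM -natr_sum ler_nat (@piece_degree_sum S ord_max) // => u u0.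
  by rewrite inE u0.
apply: (@le_trans _ _ (\sum_(j in S) (degree j)%:R / vol * (2 * m0 * e.+1%:R))).
  rewrite -mulr_suml -mulr_suml.
  apply: (@le_trans _ _ (2 * m1 / vol * (2 * m0 * e.+1%:R))).
    rewrite [leLHS](_ : _ = 2 * m1 / (nvertices G)%:R ^+ 2 * (2 * m0 * e.+1%:R)); last by ring.
    rewrite ler_wpM2r ?mulr_ge0 // ler_wpM2l ?mulr_ge0 // lef_pV2 ?posrE //.
      exact: vol_le_sqr.
    exact: lt_le_trans vol0 (vol_le_sqr _ _).
  by rewrite ler_wpM2r ?mulr_ge0 // ler_wpM2r // invr_ge0 ltW.
rewrite [leRHS](bigID (mem S)) /=; apply: (@le_trans _ _
  (\sum_(j in S) (degree j)%:R / vol * hitting R j (in_piece (x (ord0 : 'I_d))))).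
  apply: ler_sum => j; rewrite inE => /eqP jm.
  by rewrite ler_wpM2l ?hitting_across_chain // divr_ge0 // ltW.
rewrite lerDl sumr_ge0 // => j _.
by rewrite mulr_ge0 ?divr_ge0 ?(ltW vol0) // hitting_ge0 //; exact: chain_connected.
Qed.

Lemma chain_kemeny_le : fine (kemeny R G) <= (nvertices G)%:R ^+ 3.
Proof.
apply: fine_kemeny_le; first exact: chain_connected.
- exact: (in_piece (x (ord0 : 'I_d))).
- exact: exprn_ge0.
move=> i j; apply: le_trans (hitting_le R chain_connected j i) _.
by rewrite exprSr ler_wpM2r // vol_le_sqr.
Qed.

Lemma complement_chain_degree (u : complement G) : (2 * e - 1 <= degree u)%N.
Proof.
have := complement_degree (u : G); have := chain_degree u.
by rewrite chain_nvertices /d; lia.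
Qed.

Lemma complement_chain_common (u v : complement G) :
  (e - 6 <= #|[set w | sedge u w && sedge w v]%SET|)%N.
Proof.
apply: leq_trans (common_neighbours complement_chain_degree u v).
by rewrite [nvertices _]chain_nvertices; lia.
Qed.

Hypothesis e_large : (6 < e)%N.

Lemma complement_chain_connected : gconnected (complement G).
Proof.
apply: common_neighbours_connected => u v.
by apply: leq_trans (complement_chain_common u v); rewrite subn_gt0.
Qed.

Lemma complement_chain_kemeny_le :
  fine (kemeny R (complement G)) <= 2 * (nvertices G)%:R ^+ 2 / (e - 6)%:R.
Proof.
apply: fine_kemeny_le; first exact: complement_chain_connected.
- exact: (in_piece (x (ord0 : 'I_d))).
- by rewrite divr_ge0 // mulr_ge0 // sqr_ge0.
move=> i j; apply: (hitting_le_common R complement_chain_connected).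
  by rewrite subn_gt0.
exact: complement_chain_common.
Qed.

Lemma complement_chain_kemeny_ge :
  (2 * e - 1)%:R ^+ 2 / (nvertices G)%:R <= fine (kemeny R (complement G)).
Proof.
apply: (fine_kemeny_ge_degree R complement_chain_connected).
- by lia.
- exact: complement_chain_degree.
by rewrite [nvertices _]chain_nvertices; lia.
Qed.

End ChainGraph.

(** * Order of magnitude of the product *)

(** Here n is the number of vertices, s the number of single-vertex pieces and D
    the number of pieces.  The bounds n/3 <= D, n/4 <= s + 1 and n/2 <= 2 s - 1
    turn the product of the two lower bounds into
    4 (n/3)^4 (n/4) (n/2)^2 / n^3 = n^4 / 324, up to k0 k1. *)
Lemma product_lower_bound (R : realFieldType) (n s D k0 k1 m0 m1 K K' : R) :
  n = 3 * s + 4 -> 12 <= s -> D = s + 2 -> 0 < k0 -> 0 < k1 -> 0 <= m0 ->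
  0 <= m1 -> D ^+ 2 <= k0 * m0 -> D ^+ 2 <= k1 * m1 ->
  4 * m0 * m1 * (s + 1) / n ^+ 2 <= K -> (2 * s - 1) ^+ 2 / n <= K' ->
  n ^+ 4 <= 324 * k0 * k1 * (K * K').
Proof.
move=> nE s12 DE k0_gt0 k1_gt0 m0_ge0 m1_ge0 le0 le1 leK leK'.
have n0 : 0 < n by rewrite nE; lra.
have s1 : 0 <= s + 1 by lra.
have s2 : 0 <= 2 * s - 1 by lra.
have n2 : 0 <= n / 2 by rewrite divr_ge0 // ltW.
have n3 : 0 <= n / 3 by rewrite divr_ge0 // ltW.
have n4 : 0 <= n / 4 by rewrite divr_ge0 // ltW.
have D0 : 0 <= D by rewrite DE; lra.
have nD : n / 3 <= D by rewrite nE DE; lra.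
have ns1 : n / 4 <= s + 1 by rewrite nE; lra.
have ns2 : n / 2 <= 2 * s - 1 by rewrite nE; lra.
have sq : (n / 3) ^+ 2 <= D ^+ 2 by rewrite lerXn2r.
have sq2 : (n / 2) ^+ 2 <= (2 * s - 1) ^+ 2 by rewrite lerXn2r.
have low : 4 * m0 * m1 * (s + 1) / n ^+ 2 * ((2 * s - 1) ^+ 2 / n) <= K * K'.
  apply: ler_pM leK leK'.
    by rewrite divr_ge0 ?(exprn_ge0 _ (ltW n0)) // !mulr_ge0.
  by rewrite divr_ge0 ?(ltW n0) // exprn_ge0.
have edges : (n / 3) ^+ 2 * (n / 3) ^+ 2 <= k0 * m0 * (k1 * m1).
  apply: ler_pM; first exact: exprn_ge0.
  - exact: exprn_ge0.
  - exact: le_trans sq le0.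
  - exact: le_trans sq le1.
have sizes : n / 4 * (n / 2) ^+ 2 <= (s + 1) * (2 * s - 1) ^+ 2.
  by apply: ler_pM => //; exact: exprn_ge0.
have all_ge : (n / 3) ^+ 2 * (n / 3) ^+ 2 * (n / 4 * (n / 2) ^+ 2) <=
    k0 * m0 * (k1 * m1) * ((s + 1) * (2 * s - 1) ^+ 2).
  apply: ler_pM edges sizes; first by rewrite mulr_ge0 // exprn_ge0.
  by rewrite mulr_ge0 // exprn_ge0.
have c0 : 0 <= 324 * k0 * k1.
  by apply: mulr_ge0 (ltW k1_gt0); apply: mulr_ge0 (ltW k0_gt0); exact: ler0n.
apply: le_trans (ler_wpM2l c0 low); clear -all_ge n0.
have n0' : n != 0 by rewrite gt_eqF.
rewrite [leRHS](_ : _ = 1296 / n ^+ 3 *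
  (k0 * m0 * (k1 * m1) * ((s + 1) * (2 * s - 1) ^+ 2))); last by field.
rewrite [leLHS](_ : _ = 1296 / n ^+ 3 *
  ((n / 3) ^+ 2 * (n / 3) ^+ 2 * (n / 4 * (n / 2) ^+ 2))); last by field.
apply: ler_wpM2l all_ge; apply: divr_ge0; first exact: ler0n.
exact: exprn_ge0 (ltW n0).
Qed.

Section Product.
Variables (R : realType) (e : nat) (H : nat -> sgraph) (x y : forall i, H i).
Let d := e.+2.
Let G := chain d x y.
Hypothesis Hconn : forall i, (i < d)%N -> gconnected (H i).
Hypothesis H_ends : nvertices (H 0) = d /\ nvertices (H d.-1) = d.
Hypothesis H_mid : forall i, (0 < i < d.-1)%N -> nvertices (H i) = 1%N.
Hypothesis e_large : (11 < e)%N.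

Let KK := fine (kemeny R G) * fine (kemeny R (complement G)).
Let n : R := (nvertices G)%:R.

Let e6 : (6 < e)%N. Proof. by lia. Qed.
Let nE : n = 3 * e%:R + 4.
Proof. by rewrite /n (chain_nvertices x y H_ends H_mid) natrD natrM. Qed.
Let eR : 12 <= e%:R :> R. Proof. by rewrite (ler_nat R 12). Qed.
Let n0 : 0 < n. Proof. by rewrite nE; have := eR; lra. Qed.

Lemma kemeny_product_ge0 : 0 <= KK.
Proof.
rewrite mulr_ge0 //.
  by apply: le_trans (chain_kemeny_ge x y Hconn H_ends H_mid R); rewrite divr_ge0 ?mulr_ge0 ?exprn_ge0.
apply: le_trans (complement_chain_kemeny_ge x y H_ends H_mid R e6).
by rewrite divr_ge0 ?exprn_ge0.
Qed.

Lemma kemeny_product_le : KK <= 16 * n ^+ 4.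
Proof.
have c0 : (0 : R) < (e - 6)%:R by rewrite ltr0n subn_gt0.
have K'0 : 0 <= fine (kemeny R (complement G)).
  apply: le_trans (complement_chain_kemeny_ge x y H_ends H_mid R e6).
  by rewrite divr_ge0 ?exprn_ge0.
apply: (@le_trans _ _ (n ^+ 3 * (2 * n ^+ 2 / (e - 6)%:R))).
  apply: (@le_trans _ _ (n ^+ 3 * fine (kemeny R (complement G)))).
    by rewrite ler_wpM2r // chain_kemeny_le.
  rewrite ler_wpM2l ?exprn_ge0 ?(ltW n0) //.
  exact: complement_chain_kemeny_le.
rewrite mulrA ler_pdivrMr //.
(* As e >= 12, n = 3 e + 4 is at most 8 (e - 6). *)
rewrite [leLHS](_ : _ = 16 * n ^+ 4 * (n / 8)); last by field.
rewrite ler_wpM2l ?mulr_ge0 ?exprn_ge0 ?(ltW n0) //.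
by rewrite natrB ?(ltnW e6) // nE; have := eR; lra.
Qed.

Lemma kemeny_product_ge (k0 k1 : R) : 0 < k0 -> 0 < k1 ->
  d%:R ^+ 2 <= k0 * (nedges (H 0))%:R -> d%:R ^+ 2 <= k1 * (nedges (H d.-1))%:R ->
  n ^+ 4 <= 324 * k0 * k1 * KK.
Proof.
move=> k0_gt0 k1_gt0 le0 le1.
have dE : d%:R = e%:R + 2 :> R by rewrite /d -addn2 natrD.
have eE : (2 * e - 1)%:R = 2 * e%:R - 1 :> R by rewrite natrB ?natrM //; lia.
have := chain_kemeny_ge x y Hconn H_ends H_mid R; rewrite -(natr1 e) => leK.
have := complement_chain_kemeny_ge x y H_ends H_mid R e6; rewrite eE => leK'.
apply: (product_lower_bound nE eR dE k0_gt0 k1_gt0 _ _ le0 le1 leK leK') => //.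
Qed.

End Product.

Theorem mainTheorem6 (R : realType) (D : set nat)
    (H : nat -> nat -> sgraph) (x y : forall d i, H d i) :
  let G d := chain d (x d) (y d) in
  infinite_set D ->
  (forall d, D d -> (2 <= d)%N) ->
  (forall d, D d -> forall i, (i < d)%N -> gconnected (H d i)) ->
  (forall d, D d -> nvertices (H d 0%N) = d /\ nvertices (H d d.-1) = d) ->
  (forall d, D d -> forall i, (0 < i < d.-1)%N -> nvertices (H d i) = 1%N) ->
  Theta_along (R := R) D (fun d => (nedges (H d 0%N))%:R) (fun d => d%:R ^+ 2) ->
  Theta_along (R := R) D (fun d => (nedges (H d d.-1))%:R) (fun d => d%:R ^+ 2) ->
  Theta_along (R := R) D
    (fun d => fine (kemeny R (G d)) * fine (kemeny R (complement (G d))))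
    (fun d => (nvertices (G d))%:R ^+ 4).
Proof.
move=> G _ _ conn ends mid [_ /eqO_exP[k0 k0_gt0 near0]] [_ /eqO_exP[k1 k1_gt0 near1]].
have {}near0 : \forall d \near \oo, D d ->
  `|d%:R ^+ 2 : R| <= k0 * `|(nedges (H d 0))%:R : R| by exact: near0.
have {}near1 : \forall d \near \oo, D d ->
  `|d%:R ^+ 2 : R| <= k1 * `|(nedges (H d d.-1))%:R : R| by exact: near1.
(* From d = 14 on there are at least 12 single-vertex pieces. *)
have large : \forall d \near \oo, (13 < d)%N by exact: nbhs_infty_gt.
split; apply/eqO_exP.
- exists 16 => //; apply: filterS large => d d13 Dd.
  move: (conn d Dd) (ends d Dd) (mid d Dd) d13; rewrite /G.
  move: (x d) (y d); case: d {Dd} => [|[|e]] // x' y' conn' ends' mid' d13.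
  rewrite !ger0_norm ?exprn_ge0 //; last exact: kemeny_product_ge0.
  exact: kemeny_product_le.
- exists (324 * k0 * k1).
    by apply: mulr_gt0 k1_gt0; apply: mulr_gt0 k0_gt0; rewrite ltr0n.
  apply: filterS3 near0 near1 large => d le0 le1 d13 Dd.
  move: (conn d Dd) (ends d Dd) (mid d Dd) d13 (le0 Dd) (le1 Dd); rewrite /G.
  move: (x d) (y d); case: d {Dd le0 le1} => [|[|e]] // x' y' conn' ends' mid' d13.
  rewrite !ger0_norm ?exprn_ge0 //; last exact: kemeny_product_ge0.
  exact: kemeny_product_ge.
Qed.
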